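(* For every line $L\subset\mathbb{R}^2$ of strictly positive slope, the fibered treegram $\theta_{\mathcal{X}}^{\mathrm{bi}}|_L$ of a finite augmented metric space $\mathcal{X}=(X,d_X,f_X)$ can be recovered from (i.e. is determined by) a decorated elder-rule-staircode $\mathcal{I}^*_{\mathcal{X}}=\{(I_x,c_x)\}_{x\in X}$ of $\mathcal{X}$. That is: if $\mathcal{X}=(X,d_X,f_X)$ and $\mathcal{X}'=(X,d'_X,f'_X)$ are finite augmented metric spaces on the same set $X$, with decorated elder-rule-staircodes $\{(I_x,c_x)\}_{x\in X}$ and $\{(I'_x,c'_x)\}_{x\in X}$ (each with respect to some compatible total order and some choice of conqueror functions) satisfying $I_x=I'_x$ and $c_x=c'_x$ for all $x\in X$, then $\theta_{\mathcal{X}}^{\mathrm{bi}}|_L=\theta_{\mathcal{X}'}^{\mathrm{bi}}|_L$ for every line $L$ of strictly positive slope.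
   Context: **Setting.** A finite augmented metric space is a triple $\mathcal{X}=(X,d_X,f_X)$ with $(X,d_X)$ a finite metric space and $f_X:X\to\mathbb{R}$. Put $X_\sigma=\{x\in X:f_X(x)\le\sigma\}$. The Rips complex $\mathcal{R}_\varepsilon(X_\sigma,d_X)$ has as simplices the nonempty $A\subseteq X_\sigma$ with $d_X(a,a')\le\varepsilon$ for all $a,a'\in A$ (empty if $\varepsilon<0$). For a simplicial complex $K$, $\pi_0(K)$ is the partition of its vertex set into connected components. The Rips bipersistence treegram is the map $\theta_{\mathcal{X}}^{\mathrm{bi}}(\sigma,\varepsilon)=\pi_0(\mathcal{R}_\varepsilon(X_\sigma,d_X))$ from $\mathbb{R}^2$ to the set of partitions of subsets of $X$; its restriction to a line $L$ of positive slope is denoted $\theta_{\mathcal{X}}^{\mathrm{bi}}|_L$, and the family of all these restrictions is the fibered treegram. **Elder-rule-staircode.** For $\varepsilon\ge 0$ and $x\in X_\sigma$, $[x]_{(\sigma,\varepsilon)}$ is the set of all $x'\in X_\sigma$ joined to $x$ by a sequence in $X_\sigma$ with consecutive distances $\le\varepsilon$. A total order $<$ on $X$ is compatible with $f_X$ if $f_X(x)<f_X(x')$ implies $x<x'$. For a compatible order, $I_x:=\{(\sigma,\varepsilon)\in\mathbb{R}^2:\varepsilon\ge0,\ x\in X_\sigma,\ x=\min([x]_{(\sigma,\varepsilon)},<)\}$. **Conquerors and decoration.** For a finite metric space $(Y,d)$, $u_Y(y,y')$ is the minimal $\varepsilon\ge0$ such that there is a sequence in $Y$ from $y$ to $y'$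 with consecutive distances $\le\varepsilon$. For a total order $<$ on $Y$ and a non-minimal $y$, a $<$-conqueror of $y$ in $(Y,d)$ is an element $y'<y$ with $u_Y(y,y')\le u_Y(y,y'')$ for all $y''<y$. For non-minimal $x\in(X,<)$, a $<$-conqueror function $c_x:[f_X(x),\infty)\to X$ sends each $\sigma$ to a $<$-conqueror of $x$ in $(X_\sigma,d_X)$; for the minimum $x'$ of $(X,<)$, $c_{x'}:[f_X(x'),\infty)\to X$ is constant at $x'$. The decorated elder-rule-staircode is the $X$-indexed family of pairs $(I_x,c_x)$. *)

(* Defs.v *)
From HB Require Import structures.
From mathcomp Require Import all_boot all_order all_algebra.
From mathcomp Require Import boolp classical_sets functions reals.

Set Implicit Arguments.
Unset Strict Implicit.
Unset Printing Implicit Defensive.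

Import Order.TTheory GRing.Theory Num.Theory.
Local Open Scope ring_scope.

(* Two different metrics on the same set X are compared below, so the metric
   is a record over X and not a canonical structure on X. *)
Record augmented_metric (R : realType) (X : finType) := AugmentedMetric {
  dist : X -> X -> R;
  filt : X -> R;
  dist_ge0 : forall x y, 0 <= dist x y;
  dist_eq0 : forall x y, dist x y = 0 <-> x = y;
  dist_sym : forall x y, dist x y = dist y x;
  dist_triangle : forall x y z, dist x z <= dist x y + dist y z
}.

Definition pi0 (X : finType) (K : {set {set X}}) : {set {set X}} :=
  equivalence_partition (connect [rel x y | [set x; y]%SET \in K])
                        [set x | [set x]%SET \in K]%SET.

Definition strict_total_order (X : finType) (lt : rel X) : Prop :=
  [/\ irreflexive lt, transitive lt & forall x y, x != y -> lt x y || lt y x].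

Definition is_minimum (X : finType) (lt : rel X) (A : {set X}) (x : X) : Prop :=
  x \in A /\ forall y, y \in A -> y != x -> lt x y.

Section AugmentedMetricSpaces.
Variables (R : realType) (X : finType).
Implicit Types (M : augmented_metric R X) (Y : {set X}) (lt : rel X).

Definition sublevel M (s : R) : {set X} := [set x | filt M x <= s]%SET.

(* Taking a = a' shows that there are no simplices when e < 0. *)
Definition rips M Y (e : R) : {set {set X}} :=
  [set A : {set X} | [&& A != finset.set0, A \subset Y &
    [forall a in A, forall a' in A, dist M a a' <= e]]]%SET.

Definition bitreegram M (p : R * R) : {set {set X}} :=
  pi0 (rips M (sublevel M p.1) p.2).

Definition chained M Y (e : R) : rel X :=
  [rel x y | (x \in Y) &&
    connect [rel a b | [&& a \in Y, b \in Y & dist M a b <= e]] x y].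

Definition block M (p : R * R) (x : X) : {set X} :=
  [set y | chained M (sublevel M p.1) p.2 x y]%SET.

Definition compatible M lt : Prop :=
  strict_total_order lt /\ forall x y, filt M x < filt M y -> lt x y.

Definition staircode M lt (x : X) : set (R * R) :=
  [set p : R * R | [/\ 0 <= p.2, x \in sublevel M p.1 &
                       is_minimum lt (block M p x) x]]%classic.

(* The infimum is a minimum when y, y' \in Y, see linkageP. *)
Definition linkage M Y (y y' : X) : R :=
  inf [set e : R | 0 <= e /\ chained M Y e y y']%classic.

Definition conqueror M lt Y (y y' : X) : Prop :=
  [/\ y' \in Y, lt y' y &
      forall y'', y'' \in Y -> lt y'' y ->
        linkage M Y y y' <= linkage M Y y y''].

(* A function c : [f x, +oo) -> X is encoded as a partial function on R, which
   is None exactly below f x, so that equality of two such functions includes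
   equality of their domains. *)
Definition conqueror_function M lt (x : X) (c : R -> option X) : Prop :=
  (forall s, s < filt M x -> c s = None) /\
  (forall s, filt M x <= s -> exists2 y, c s = Some y &
     (is_minimum lt [set: X]%SET x -> y = x) /\
     (~ is_minimum lt [set: X]%SET x -> conqueror M lt (sublevel M s) x y)).

Definition decorated_staircode M
    (S : X -> set (R * R) * (R -> option X)) : Prop :=
  exists lt, compatible M lt /\
    forall x, (S x).1 = staircode M lt x /\ conqueror_function M lt x (S x).2.

Definition positive_slope_line (L : set (R * R)) : Prop :=
  exists m b : R, 0 < m /\ L = [set p : R * R | p.2 = m * p.1 + b]%classic.

Definition fibered_treegram M (L : set (R * R)) : L -> {set {set X}} :=
  sigL L (bitreegram M).

Lemma linkageP M Y (y y' : X) : y \in Y -> y' \in Y ->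
  [/\ 0 <= linkage M Y y y', chained M Y (linkage M Y y y') y y' &
      forall e, 0 <= e -> chained M Y e y y' -> linkage M Y y y' <= e].
Proof.
move=> Yy Yy'.
pose P := [pred q : X * X | chained M Y (dist M q.1 q.2) y y'].
have P0 : P (y, y').
  by rewrite /P /= /chained /= Yy; apply: connect1; rewrite /= Yy Yy' lexx.
pose q := [arg min_(q < (y, y') | P q) dist M q.1 q.2]%O.
have [Pq qmin] : P q /\ forall r, P r -> dist M q.1 q.2 <= dist M r.1 r.2.
  by rewrite /q; case: arg_minP.
have lb e : 0 <= e -> chained M Y e y y' -> dist M q.1 q.2 <= e.
  move=> e0 ch.
  pose Q := [pred r : X * X | dist M r.1 r.2 <= e].
  have dyy : dist M y y = 0 by apply/dist_eq0.
  have Q0 : Q (y, y) by rewrite /Q /= dyy.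
  pose r := [arg max_(r > (y, y) | Q r) dist M r.1 r.2]%O.
  have [Qr rmax] : Q r /\ forall t, Q t -> dist M t.1 t.2 <= dist M r.1 r.2.
    by rewrite /r; case: arg_maxP.
  apply: (le_trans (qmin r _) Qr); rewrite /P /= /chained /= Yy.
  case/andP: ch => _; apply: connect_sub => a b /and3P[Ya Yb dab].
  by apply: connect1; rewrite /= Ya Yb /=; exact: (rmax (a, b)).
have -> : linkage M Y y y' = dist M q.1 q.2.
  apply/eqP; rewrite eq_le; apply/andP; split.
    by apply: ge_inf; [exists 0 => e /= [] | split => //; exact: dist_ge0].
  apply: lb_le_inf; last by move=> e /= [e0 ch]; exact: lb.
  by exists (dist M q.1 q.2); split => //; exact: dist_ge0.
by split => //; exact: dist_ge0.
Qed.

End AugmentedMetricSpaces.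

Arguments fibered_treegram {R X} M L _.

(* Main.v *)
Require Import Defs.
From mathcomp Require Import all_boot all_order all_algebra.
From mathcomp Require Import boolp classical_sets functions reals.

(* Let Y be the sublevel set at s and let e >= 0.  If (s, e) lies outside I_x,
   then x is not minimal in its block, so the conqueror of x at s precedes x
   and lies in the same block.  Iterating the map that fixes x if (s, e) is in
   I_x and sends x to c_x(s) otherwise therefore ends at the minimum of the
   block of x, and two points share a block iff their orbits under this map
   meet.  The map depends only on the decorated staircode, even if the two
   staircodes come from different orders; the sublevel sets depend only on the
   domains of the functions c_x. *)

Set Implicit Arguments.
Unset Strict Implicit.
Unset Printing Implicit Defensive.

Import Order.TTheory GRing.Theory Num.Theory.
Local Open Scope ring_scope.

Lemma chained_refl (R : realType) (X : finType) (M : augmented_metric R X)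
  (Y : {set X}) (e : R) (x : X) : x \in Y -> chained M Y e x x.
Proof. by move=> Yx; rewrite /chained /= Yx connect0. Qed.

(** [chained] only asks that the starting point lie in [Y]; every edge of the path carries
    membership on to its endpoint. *)
Lemma chained_mem (R : realType) (X : finType) (M : augmented_metric R X)
  (Y : {set X}) (e : R) (x y : X) : chained M Y e x y -> y \in Y.
Proof.
case/andP=> Yx /connectP[p]; elim: p x Yx => [|z p IHp] x Yx /=.
  by move=> _ ->.
by case/andP=> /and3P[_ Yz _]; exact: IHp.
Qed.

Lemma chained_sym (R : realType) (X : finType) (M : augmented_metric R X)
  (Y : {set X}) (e : R) (x y : X) : chained M Y e x y -> chained M Y e y x.
Proof.
move=> ch; have Yy := chained_mem ch; case/andP: ch => _ cxy.
rewrite /chained /= Yy sym_connect_sym // => a b /=.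
by rewrite dist_sym andbCA.
Qed.

Lemma chained_trans (R : realType) (X : finType) (M : augmented_metric R X)
  (Y : {set X}) (e : R) (x y z : X) :
  chained M Y e x y -> chained M Y e y z -> chained M Y e x z.
Proof.
move=> /andP[Yx cxy] /andP[_ cyz].
by rewrite /chained /= Yx; exact: connect_trans cxy cyz.
Qed.

Lemma chained_le (R : realType) (X : finType) (M : augmented_metric R X)
  (Y : {set X}) (e e' : R) (x y : X) :
  e <= e' -> chained M Y e x y -> chained M Y e' x y.
Proof.
move=> le_ee' /andP[Yx cxy]; rewrite /chained /= Yx.
apply: connect_sub cxy => a b /and3P[Ya Yb dab].
by apply: connect1; rewrite /= Ya Yb (le_trans dab).
Qed.

Lemma rips_edge (R : realType) (X : finType) (M : augmented_metric R X)
  (Y : {set X}) (e : R) (x y : X) :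
  ([set x; y]%SET \in rips M Y e) = [&& x \in Y, y \in Y & dist M x y <= e].
Proof.
have d0 z : dist M z z = 0 by apply/dist_eq0.
rewrite inE; apply/and3P/and3P => [[_ /fintype.subsetP sY /forall_inP dle]|].
  split; [by apply: sY; rewrite !inE eqxx | | ].
    by apply: sY; rewrite !inE eqxx orbT.
  have /forall_inP := dle x (set21 _ _).
  by apply; rewrite set22.
move=> [Yx Yy dxy]; split; first by apply/finset.set0Pn; exists x; rewrite set21.
  by apply/fintype.subsetP => z; rewrite !inE => /orP[]/eqP->.
(* The diagonal distances vanish, so the simplex condition also needs [0 <= e]. *)
have e0 : 0 <= e by exact: le_trans (dist_ge0 M x y) dxy.
apply/forall_inP => a; rewrite !inE => ha; apply/forall_inP => b.
by rewrite !inE; case/orP: ha => /eqP-> /orP[]/eqP->; rewrite ?d0 // dist_sym.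
Qed.

Lemma rips_vertex (R : realType) (X : finType) (M : augmented_metric R X)
  (Y : {set X}) (e : R) (x : X) :
  ([set x]%SET \in rips M Y e) = (x \in Y) && (0 <= e).
Proof.
have d0 : dist M x x = 0 by apply/dist_eq0.
by rewrite -[[set x]%SET]finset.setUid rips_edge d0 andbA andbb.
Qed.

(** Components depend only on vertices and edges. The case split is needed because [chained] stays
    reflexive on [Y] for [e < 0], where the complex is empty. *)
Lemma pi0_ripsE (R : realType) (X : finType) (M : augmented_metric R X)
  (Y : {set X}) (e : R) :
  pi0 (rips M Y e) =
  if 0 <= e then [set [set y in Y | chained M Y e x y] | x in Y]%SET
  else finset.set0.
Proof.
rewrite /pi0 /equivalence_partition.
have -> : [set x | [set x]%SET \in rips M Y e]%SET
          = if 0 <= e then Y else finset.set0.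
  apply/setP => x; rewrite inE rips_vertex.
  by case: ifP; rewrite ?andbT ?andbF ?inE.
case: ifP => _; last exact: imset0.
apply: eq_in_imset => x Yx; apply/setP => y; rewrite !inE /chained /= Yx /=.
by congr (_ && _); apply: eq_connect => a b /=; rewrite rips_edge.
Qed.

(** Some [z] in the block of [x] precedes [x]. A conqueror has linkage at most that of [z], hence at
    most [p.2], and is chained to [x] at its own linkage. *)
Lemma staircode_conqueror_chained (R : realType) (X : finType)
  (M : augmented_metric R X) (lt : rel X) (x : X) (c : R -> option X)
  (p : R * R) :
  compatible M lt -> conqueror_function M lt x c ->
  0 <= p.2 -> x \in sublevel M p.1 -> ~ staircode M lt x p ->
  exists y, [/\ c p.1 = Some y, lt y x & chained M (sublevel M p.1) p.2 x y].
Proof.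
move=> [[lt_irr lt_tr lt_tot] _] [_ cS] e0 Yx nI.
have fx : filt M x <= p.1 by move: Yx; rewrite inE.
have [y cy [_ conq]] := cS _ fx.
(* A global minimum would be minimal in its block too, so the genuine conqueror clause applies. *)
have nmin : ~ is_minimum lt [set: X]%SET x.
  move=> [_ minx]; apply: nI; split=> //; split.
    by rewrite inE chained_refl.
  by move=> z _; apply: minx; rewrite inE.
have [Yy ltyx ymin] := conq nmin; exists y; split=> //.
have [z zB ltzx] : exists2 z, z \in block M p x & lt z x.
  apply: contrapT => nz; apply: nI; split=> //; split.
    by rewrite inE chained_refl.
  move=> z zB zx; have /orP[ltzx|//] := lt_tot _ _ zx.
  by case: nz; exists z.
rewrite inE in zB; have Yz := chained_mem zB.
have [_ _ lz] := linkageP M Yx Yz; have [_ chy _] := linkageP M Yx Yy.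
by apply: chained_le chy; exact: le_trans (ymin _ Yz ltzx) (lz _ e0 zB).
Qed.

(** For a decorated staircode, the default of [odflt] is reached only outside the sublevel set,
    where the conqueror function is undefined. *)
Definition conqueror_step (R : realType) (X : finType)
    (S : X -> set (R * R) * (R -> option X)) (p : R * R) (x : X) : X :=
  if `[< (S x).1 p >] then x else odflt x ((S x).2 p.1).

(** Outside the staircode a step strictly descends in [lt], so induction on the number of
    predecessors ends at a block minimum. *)
Lemma conqueror_step_root (R : realType) (X : finType)
  (M : augmented_metric R X) (lt : rel X)
  (S : X -> set (R * R) * (R -> option X)) (p : R * R) (x : X) :
  compatible M lt ->
  (forall x, (S x).1 = staircode M lt x /\ conqueror_function M lt x (S x).2) ->
  0 <= p.2 -> x \in sublevel M p.1 ->
  exists z, [/\ fconnect (conqueror_step S p) x z, staircode M lt z p &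
                chained M (sublevel M p.1) p.2 x z].
Proof.
move=> cM SM e0; have [[lt_irr lt_tr _] _] := cM.
have [n] := ubnP #|[set z | lt z x]%SET|; elim: n x => // n IHn x ltn Yx.
have [Ix|nI] := pselect (staircode M lt x p).
  by exists x; split; rewrite ?connect0 ?chained_refl.
have [y [cy ltyx chy]] :=
  staircode_conqueror_chained cM (SM x).2 e0 Yx nI.
have [|z [yz Iz chz]] := IHn y _ (chained_mem chy).
  (* Predecessors of [y] precede [x] as well, and [y] itself is no longer counted. *)
  rewrite ltnS in ltn; apply: leq_trans ltn; apply: proper_card.
  apply/properP; split.
    by apply/fintype.subsetP => z; rewrite !inE => /lt_tr; apply.
  by exists y; rewrite !inE ?lt_irr.
exists z; split=> //; last exact: chained_trans chy chz.
apply: connect_trans yz; apply: connect1; rewrite /= /conqueror_step.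
by rewrite (SM x).1 asboolF // cy.
Qed.

Lemma fconnect_conqueror_step_chained (R : realType) (X : finType)
  (M : augmented_metric R X) (lt : rel X)
  (S : X -> set (R * R) * (R -> option X)) (p : R * R) (x y : X) :
  compatible M lt ->
  (forall x, (S x).1 = staircode M lt x /\ conqueror_function M lt x (S x).2) ->
  0 <= p.2 -> x \in sublevel M p.1 ->
  fconnect (conqueror_step S p) x y -> chained M (sublevel M p.1) p.2 x y.
Proof.
move=> cM SM e0 Yx /connectP[s]; elim: s x Yx => [|z s IHs] x Yx /=.
  by move=> _ ->; exact: chained_refl.
case/andP=> /eqP defz zs lasty.
have chz : chained M (sublevel M p.1) p.2 x z.
  rewrite -defz /conqueror_step; case: asboolP => [_|].
    exact: chained_refl.
  rewrite (SM x).1 => nI.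
  by have [u [-> _]] := staircode_conqueror_chained cM (SM x).2 e0 Yx nI.
exact: chained_trans chz (IHs _ (chained_mem chz) zs lasty).
Qed.

(** The right-hand side mentions neither the metric nor the order, which lets two metrics be
    compared through [S]. *)
Lemma chained_conqueror_stepE (R : realType) (X : finType)
  (M : augmented_metric R X) (S : X -> set (R * R) * (R -> option X))
  (p : R * R) (x y : X) :
  decorated_staircode M S -> 0 <= p.2 ->
  x \in sublevel M p.1 -> y \in sublevel M p.1 ->
  chained M (sublevel M p.1) p.2 x y =
  [exists z, fconnect (conqueror_step S p) x z &&
             fconnect (conqueror_step S p) y z].
Proof.
move=> [lt [cM SM]] e0 Yx Yy; have [[lt_irr lt_tr _] _] := cM.
apply/idP/existsP => [chxy|[z /andP[xz yz]]]; last first.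
  apply: (@chained_trans _ _ _ _ _ _ z).
    exact: fconnect_conqueror_step_chained cM SM e0 Yx xz.
  by apply: chained_sym; exact: fconnect_conqueror_step_chained cM SM e0 Yy yz.
have [z [xz [_ _ [_ minz]] chxz]] := conqueror_step_root cM SM e0 Yx.
have [w [yw [_ _ [_ minw]] chyw]] := conqueror_step_root cM SM e0 Yy.
have chzw : chained M (sublevel M p.1) p.2 z w.
  exact: chained_trans (chained_sym chxz) (chained_trans chxy chyw).
exists z; rewrite xz; suff -> : z = w by [].
(* The roots [z] and [w] are minima of the same block; if distinct, each would precede the other. *)
apply/eqP/negPn/negP => zw.
have ltzw : lt z w by apply: minz; [rewrite inE | rewrite eq_sym].
have ltwz : lt w z by apply: minw => //; rewrite inE chained_sym.
by have := lt_tr _ _ _ ltzw ltwz; rewrite lt_irr.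
Qed.

(** The option is read as a boolean, true on [Some], that is, on the domain of the conqueror
    function. *)
Lemma sublevel_decorated_staircode (R : realType) (X : finType)
  (M : augmented_metric R X) (S : X -> set (R * R) * (R -> option X)) (s : R) :
  decorated_staircode M S -> sublevel M s = [set x | (S x).2 s]%SET.
Proof.
move=> [lt [_ SM]]; apply/setP => x; rewrite !inE.
have [_ [cN cS]] := SM x; case: (leP (filt M x) s) => [/cS[y -> _] //|/cN -> //].
Qed.

Lemma eq_decorated_staircode_bitreegram (R : realType) (X : finType)
  (M M' : augmented_metric R X) (S : X -> set (R * R) * (R -> option X)) :
  decorated_staircode M S -> decorated_staircode M' S ->
  bitreegram M = bitreegram M'.
Proof.
move=> dM dM'; apply/funext => p; rewrite /bitreegram !pi0_ripsE.
have eqY : sublevel M p.1 = sublevel M' p.1.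
  by rewrite !(@sublevel_decorated_staircode _ _ _ S).
case: ifP => // e0; rewrite [in RHS]/= -eqY.
apply: eq_in_imset => x Yx; apply/setP => y; rewrite [LHS]finset.in_set [RHS]finset.in_set.
apply: andb_id2l => Yy.
rewrite (chained_conqueror_stepE dM) // eqY (chained_conqueror_stepE dM') //.
- by rewrite -eqY.
- by rewrite -eqY.
Qed.

Theorem theorem4p13 (R : realType) (X : finType)
  (M M' : augmented_metric R X)
  (S S' : X -> set (R * R) * (R -> option X))
  (hS : decorated_staircode M S)
  (hS' : decorated_staircode M' S')
  (hI : forall x : X, (S x).1 = (S' x).1)
  (hc : forall x : X, (S x).2 = (S' x).2)
  (L : set (R * R)) (hL : positive_slope_line L) :
  fibered_treegram M L = fibered_treegram M' L.
Proof.
(* Extensionality merges the two families, so that a single [S] decorates both metrics. *)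
have eqS : S = S'.
  by apply/funext => x; rewrite [S x]surjective_pairing hI hc -surjective_pairing.
rewrite -eqS in hS'.
by rewrite /fibered_treegram (eq_decorated_staircode_bitreegram hS hS').
Qed.
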